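(* Let $\mathcal{A}\subset\mathbb{C}$ be a finite constellation with at least two points, from which the four information symbols $x_1,\dots,x_4$ of the differential combined MDC-QOSTBC with four transmit antennas are drawn. Let $a_1,a_2>0$ be the amplitudes of the previous block in the two equivalent subsystems, and let $\mathbf{V}'(x_1,\dots,x_4)$ denote the actual information matrix defined in the context. Then, with $a_1,a_2$ fixed, the minimum of $\det\big(\mathbf{V}'(x)-\mathbf{V}'(\tilde x)\big)$ over all pairs of distinct $x,\tilde x\in\mathcal{A}^4$ equals $$C\cdot\min\big((\Delta x^R)^2-(\Delta x^I)^2\big)^2,$$ where the minimum is over all differences $\Delta x=\Delta x^R+j\Delta x^I$ of two distinct points of $\mathcal{A}$, and $C>0$ is a constant not depending on the constellation. In particular, if $|\Delta x^R|\neq|\Delta x^I|$ for the difference $\Delta x=\Delta x^R+j\Delta x^I$ of any two distinct points of $\mathcal{A}$, then the code achieves full diversity, i.e. $\mathbf{V}'(x)-\mathbf{V}'(\tilde x)$ has full rank $4$ for all distinct $x,\tilde x\in\mathcal{A}^4$.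
   Context: For $x\in\mathbb{C}$ write $x=x^R+jx^I$ with $x^R,x^I\in\mathbb{R}$, $j=\sqrt{-1}$; $^*$ is complex conjugation. Scheme. Given $x_1,\dots,x_4\in\mathcal{A}$ put $v_1=x_1^R+jx_3^R$, $v_2=x_2^R+jx_4^R$, $v_3=-x_1^I+jx_3^I$, $v_4=-x_2^I+jx_4^I$, and $c_1=v_1+v_3$, $c_2=v_2+v_4$, $c_3=v_1-v_3$, $c_4=v_2-v_4$. With normalization $p=4$, the information matrices of the two equivalent $2\times2$ subsystems are $\frac{1}{\sqrt p}\begin{pmatrix} c_1 & c_2 \\ -c_2^* & c_1^* \end{pmatrix}$ and $\frac{1}{\sqrt p}\begin{pmatrix} c_3 & c_4 \\ -c_4^* & c_3^* \end{pmatrix}$. Each subsystem is differentially encoded by multiplying its previous transmit matrix on the left by its new information matrix divided by the amplitude ($a_1$, respectively $a_2$) of its previous block; the subsystem transmit matrices are $\mathbf{A}+\mathbf{B}$ and $\mathbf{A}-\mathbf{B}$, where $\begin{pmatrix} \mathbf{A} & \mathbf{B} \\ \mathbf{B} & \mathbf{A} \end{pmatrix}$ is the actual $4\times4$ transmit matrix. Actual information matrix. The $4\times4$ matrix by which the previous actual transmit matrix is left-multiplied to obtain the new one is $$\mathbf{V}'(x_1,\dots,x_4)=\begin{pmatrix} v_1' & v_2' & v_3' & v_4' \\ -v_2'^* & v_1'^* & -v_4'^* & v_3'^* \\ {} v_3' & v_4' & v_1' & v_2' \\ -v_4'^* & v_3'^* & -v_2'^* & v_1'^* \end{pmatrix},$$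 with $v_1'=\frac{1}{2\sqrt p}\big(\frac{c_1}{a_1}+\frac{c_3}{a_2}\big)$, $v_2'=\frac{1}{2\sqrt p}\big(\frac{c_2}{a_1}+\frac{c_4}{a_2}\big)$, $v_3'=\frac{1}{2\sqrt p}\big(\frac{c_1}{a_1}-\frac{c_3}{a_2}\big)$, $v_4'=\frac{1}{2\sqrt p}\big(\frac{c_2}{a_1}-\frac{c_4}{a_2}\big)$. The diversity order (one receive antenna) is the minimum rank of $\mathbf{V}'(x)-\mathbf{V}'(\tilde x)$ over distinct $x,\tilde x\in\mathcal{A}^4$; full diversity means it equals $4$. *)

(* Defs.v *)
From HB Require Import structures.
From mathcomp Require Import all_boot all_order all_algebra.
From mathcomp Require Import finmap complex.
From mathcomp Require Import boolp classical_sets reals.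

Set Implicit Arguments.
Unset Strict Implicit.
Unset Printing Implicit Defensive.

Import Order.TTheory GRing.Theory Num.Theory.

Local Open Scope classical_set_scope.
Local Open Scope ring_scope.
Local Open Scope complex_scope.

(* On R[i] the order is the partial one ([z <= w] iff [Im z = Im w] and
   [Re z <= Re w]), so a set of complex numbers with a real minimum consists
   of real numbers only. *)
Definition is_minimum (d : Order.disp_t) (T : porderType d) (S : set T)
    (m : T) : Prop :=
  S m /\ lbound S m.

Section Code.
Variable R : realType.

(* The normalization p = 4. *)
Definition sqrt_p : R := Num.sqrt 4.

(* The factor on the left of the previous transmit matrix; [w1], .., [w4] are
   the entries v'_1, .., v'_4.  [complex.Re] and [complex.Im] are R-valued,
   whereas [Re] and [Im] now denote the R[i]-valued projections of [Num]. *)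
Definition info_matrix (a1 a2 : R) (x1 x2 x3 x4 : R[i]) : 'M[R[i]]_4 :=
  let v1 := complex.Re x1 +i* complex.Re x3 in
  let v2 := complex.Re x2 +i* complex.Re x4 in
  let v3 := - complex.Im x1 +i* complex.Im x3 in
  let v4 := - complex.Im x2 +i* complex.Im x4 in
  let c1 := v1 + v3 in
  let c2 := v2 + v4 in
  let c3 := v1 - v3 in
  let c4 := v2 - v4 in
  let w1 := ((2 * sqrt_p)^-1)%:C * (c1 / a1%:C + c3 / a2%:C) in
  let w2 := ((2 * sqrt_p)^-1)%:C * (c2 / a1%:C + c4 / a2%:C) in
  let w3 := ((2 * sqrt_p)^-1)%:C * (c1 / a1%:C - c3 / a2%:C) in
  let w4 := ((2 * sqrt_p)^-1)%:C * (c2 / a1%:C - c4 / a2%:C) in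
  let rows :=
    [:: [:: w1; w2; w3; w4];
        [:: - Num.conj w2; Num.conj w1; - Num.conj w4; Num.conj w3];
        [:: w3; w4; w1; w2];
        [:: - Num.conj w4; Num.conj w3; - Num.conj w2; Num.conj w1] ] in
  \matrix_(i < 4, j < 4) (nth [::] rows i)`_j.

Definition codeword_diff (a1 a2 : R) (x y : 4.-tuple R[i]) : 'M[R[i]]_4 :=
  info_matrix a1 a2 x`_0 x`_1 x`_2 x`_3 - info_matrix a1 a2 y`_0 y`_1 y`_2 y`_3.

Definition diff_dets (a1 a2 : R) (A : {fset R[i]}) : set R[i] :=
  [set z | exists x y : 4.-tuple R[i],
     [/\ {subset x <= A}, {subset y <= A}, x != y
       & z = \det (codeword_diff a1 a2 x y)]].

Definition diff_ranks (a1 a2 : R) (A : {fset R[i]}) : set nat :=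
  [set r | exists x y : 4.-tuple R[i],
     [/\ {subset x <= A}, {subset y <= A}, x != y
       & r = \rank (codeword_diff a1 a2 x y)]].

Definition point_gaps (A : {fset R[i]}) : set R :=
  [set g | exists s t : R[i],
     [/\ s \in A, t \in A, s != t
       & g = (complex.Re (s - t) ^+ 2 - complex.Im (s - t) ^+ 2) ^+ 2]].

Definition diversity_order (a1 a2 : R) (A : {fset R[i]}) (r : nat) : Prop :=
  is_minimum (diff_ranks a1 a2 A) r.

Definition full_diversity (a1 a2 : R) (A : {fset R[i]}) : Prop :=
  diversity_order a1 a2 A 4.

End Code.

(* Main.v *)
(** The matrix has the block form [[P, Q], [Q, P]], so its determinant is
    [\det (P + Q) * \det (P - Q)], and [P + Q], [P - Q] are the orthogonal
    2x2 information matrices of the two subsystems.  With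
    [u k = dRe k - dIm k] and [v k = dRe k + dIm k] for the symbol differences,
    the two factors are, up to constants, sums of four squares in which each
    symbol contributes one of [u k ^+ 2], [v k ^+ 2] to one factor and the other
    to the other factor.  Hence the product is at least
    [(u k * v k) ^+ 2 = (dRe k ^+ 2 - dIm k ^+ 2) ^+ 2] for every [k], with
    equality when only the [k]-th symbols differ. *)

Require Import Defs.
From HB Require Import structures.
From mathcomp Require Import all_boot all_order all_algebra.
From mathcomp Require Import finmap complex.
From mathcomp Require Import boolp classical_sets reals.
From mathcomp Require Import ring lra.

Set Implicit Arguments.
Unset Strict Implicit.

Import Order.TTheory GRing.Theory Num.Theory.

Local Open Scope ring_scope.
Local Open Scope complex_scope.

(** Adding the second block row to the first, then subtracting the first block column from the
    second, gives a block lower triangular matrix. Both operations have determinant 1, so no inverse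
    of 2 is needed. *)
Lemma det_block_circulant (F : comPzRingType) (n : nat) (P Q : 'M[F]_n) :
  \det (block_mx P Q Q P) = \det (P + Q) * \det (P - Q).
Proof.
have E : block_mx 1%:M 1%:M 0 1%:M *m block_mx P Q Q P
           *m block_mx 1%:M (- 1%:M) 0 1%:M = block_mx (P + Q) 0 Q (P - Q).
  rewrite !mulmx_block !mul1mx !mulmx1 !mul0mx !mulmx0 !mulmxN !mulmx1 !add0r.
  rewrite !addr0 [Q + P]addrC addNr.
  by congr block_mx; rewrite addrC.
have := congr1 determinant E.
by rewrite !det_mulmx !det_ublock det_lblock !det1 !mul1r !mulr1.
Qed.

Lemma det_mx2 (F : comPzRingType) (M : 'M[F]_2) :
  \det M = M 0 0 * M 1 1 - M 0 1 * M 1 0.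
Proof.
rewrite (expand_det_row _ 0) !big_ord_recl big_ord0 addr0 /cofactor.
rewrite !det_mx11 !mxE /= expr0 expr1 !mul1r mulN1r mulrN.
by congr (M _ _ * M _ _ - M _ _ * M _ _); apply: val_inj.
Qed.

Section Determinant.
Variable R : realType.
Implicit Types (a : R) (d s t : R[i]) (x y : 4.-tuple R[i]) (A : {fset R[i]}).

Definition gap d : R := (complex.Re d ^+ 2 - complex.Im d ^+ 2) ^+ 2.

Definition sqdiff d : R := (complex.Re d - complex.Im d) ^+ 2.
Definition sqsum d : R := (complex.Re d + complex.Im d) ^+ 2.

(** With [p = sqrt_p ^+ 2], this is the product of the scalings [1 / (p * a1 ^+ 2)] and
    [1 / (p * a2 ^+ 2)] of the two subsystem determinants. *)
Definition det_const a1 a2 : R :=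
  ((sqrt_p R)^-1) ^+ 4 * (a1^-1 * a2^-1) ^+ 2.

Lemma det_const_gt0 a1 a2 : 0 < a1 -> 0 < a2 -> 0 < det_const a1 a2.
Proof.
move=> a1_gt0 a2_gt0.
by rewrite mulr_gt0 ?exprn_gt0 ?mulr_gt0 ?invr_gt0 ?sqrtr_gt0.
Qed.

(** In the notation of [info_matrix], these are [|c1|^2 + |c2|^2] and [|c3|^2 + |c4|^2]. *)
Definition det_factor1 d1 d2 d3 d4 : R :=
  sqdiff d1 + sqdiff d2 + sqsum d3 + sqsum d4.
Definition det_factor2 d1 d2 d3 d4 : R :=
  sqsum d1 + sqsum d2 + sqdiff d3 + sqdiff d4.

(** Every entry, conjugated or not, is real-linear in the real and imaginary parts of the
    symbols. *)
Lemma info_matrixB a1 a2 (x1 x2 x3 x4 y1 y2 y3 y4 : R[i]) :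
  info_matrix a1 a2 x1 x2 x3 x4 - info_matrix a1 a2 y1 y2 y3 y4 =
  info_matrix a1 a2 (x1 - y1) (x2 - y2) (x3 - y3) (x4 - y4).
Proof.
rewrite /info_matrix -!fmorphV.
case: x1 x2 x3 x4 y1 y2 y3 y4
  => [? ?] [? ?] [? ?] [? ?] [? ?] [? ?] [? ?] [? ?].
apply/matrixP => i j; rewrite !mxE.
case: i j => [[|[|[|[|//]]]] ?] [[|[|[|[|//]]]] ?] /=.
all: by apply/eqP; rewrite eq_complex /=; apply/andP; split; apply/eqP; ring.
Qed.

Lemma det_info_matrix a1 a2 d1 d2 d3 d4 :
  \det (info_matrix a1 a2 d1 d2 d3 d4) =
  (det_const a1 a2 * (det_factor1 d1 d2 d3 d4 * det_factor2 d1 d2 d3 d4))%:C.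
Proof.
(* The size is retyped as [2 + 2] so that [M] splits into 2x2 blocks. *)
set M : 'M_(2 + 2) := info_matrix _ _ _ _ _ _.
rewrite -[LHS]/(\det M) -[M]submxK.
have -> : drsubmx M = ulsubmx M.
  apply/matrixP => i j; rewrite !mxE.
  by case: i j => [[|[|//]] ?] [[|[|//]] ?].
have -> : dlsubmx M = ursubmx M.
  apply/matrixP => i j; rewrite !mxE.
  by case: i j => [[|[|//]] ?] [[|[|//]] ?].
rewrite det_block_circulant !det_mx2 !mxE /= /det_const invfM -!fmorphV.
rewrite /det_factor1 /det_factor2 /sqdiff /sqsum.
(* With these inverses abstracted, the only denominator left is the numeral 2, so [field] needs no
   condition on the amplitudes. *)
move: a1^-1 a2^-1 (sqrt_p R)^-1 => b1 b2 r.
case: d1 d2 d3 d4 {M} => [? ?] [? ?] [? ?] [? ?].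
apply/eqP; rewrite eq_complex /=; apply/andP; split; apply/eqP; by field.
Qed.

Lemma gapE d : gap d = sqdiff d * sqsum d.
Proof. by rewrite /gap /sqdiff /sqsum; ring. Qed.

Lemma gap_eq0 d : (gap d == 0) = (`|complex.Re d| == `|complex.Im d|).
Proof. by rewrite sqrf_eq0 subr_eq0 eqf_sqr eqr_norm2. Qed.

Lemma gap_le_factors (d : nat -> R[i]) (k : nat) : (k < 4)%N ->
  gap (d k) <=
    det_factor1 (d 0) (d 1) (d 2) (d 3) * det_factor2 (d 0) (d 1) (d 2) (d 3).
Proof.
have P i : 0 <= sqdiff (d i) by exact: sqr_ge0.
have Q i : 0 <= sqsum (d i) by exact: sqr_ge0.
have := (P 0, P 1, P 2, P 3, Q 0, Q 1, Q 2, Q 3).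
move=> [] [] [] [] [] [] [] p0 p1 p2 p3 q0 q1 q2 q3.
rewrite gapE /det_factor1 /det_factor2.
(* The last two symbols contribute [sqsum] to the first factor and [sqdiff] to the second, hence the
   swap before comparing factor by factor. *)
by move: k => [|[|[|[|//]]]] _; [| | rewrite mulrC..]; rewrite ler_pM //; lra.
Qed.

Lemma det_codeword_diff a1 a2 x y :
  let d k := x`_k - y`_k in
  \det (codeword_diff a1 a2 x y) =
  (det_const a1 a2 *
    (det_factor1 (d 0) (d 1) (d 2) (d 3) *
     det_factor2 (d 0) (d 1) (d 2) (d 3)))%:C.
Proof. by rewrite /codeword_diff info_matrixB det_info_matrix. Qed.

Lemma tuple4_neqP x y : x != y -> exists2 k, (k < 4)%N & x`_k != y`_k.
Proof.
move=> neq_xy; have [k neq_k] : exists k : 'I_4, tnth x k != tnth y k.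
  apply/existsP; apply: contraNT neq_xy; rewrite negb_exists => /forallP eq_xy.
  by apply/eqP/eq_from_tnth => k; apply/eqP; rewrite -[_ == _]negbK.
by exists k => //; rewrite -!tnth_nth.
Qed.

Lemma nth_subset_mem A x k : {subset x <= A} -> (k < 4)%N -> x`_k \in A.
Proof. by move=> sxA lt_k; rewrite sxA // mem_nth // size_tuple. Qed.

(** This bound serves twice: as the lower bound in the minimum, and to keep the determinant away
    from 0 in the rank claim. *)
Lemma codeword_diff_gap A a1 a2 x y : 0 < a1 -> 0 < a2 ->
  {subset x <= A} -> {subset y <= A} -> x != y ->
  exists s t, [/\ s \in A, t \in A, s != t &
    (det_const a1 a2 * gap (s - t))%:C <= \det (codeword_diff a1 a2 x y)].
Proof.
move=> a1_gt0 a2_gt0 sxA syA /tuple4_neqP[k lt_k neq_k].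
exists x`_k, y`_k; split; rewrite ?nth_subset_mem //.
rewrite det_codeword_diff lecR ler_pM2l ?det_const_gt0 //.
exact: (gap_le_factors (fun k => x`_k - y`_k) lt_k).
Qed.

Lemma exists_neq_fset A : (1 < #|` A|)%N ->
  exists s t, [/\ s \in A, t \in A & s != t].
Proof.
move=> A_gt1; have /fset0Pn[s sA] : A != fset0.
  by rewrite -cardfs_gt0 ltnW.
have /fset0Pn[t] : (A `\ s)%fset != fset0.
  by rewrite -cardfs_gt0; move: A_gt1; rewrite (cardfsD1 s) sA.
by rewrite in_fsetD1 => /andP[neq_ts tA]; exists s, t; rewrite eq_sym.
Qed.

Lemma point_gaps_minimum A : (1 < #|` A|)%N ->
  exists m, is_minimum (point_gaps A) m.
Proof.
case/exists_neq_fset=> s [t [sA tA neq_st]].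
pose P (p : A * A) := val p.1 != val p.2.
have P0 : P ([` sA]%fset, [` tA]%fset) by [].
(* The minimum is taken over the finite type [A * A], with the known distinct pair as a starting
   candidate. *)
case: (arg_minP (fun p : A * A => gap (val p.1 - val p.2)) P0) => [[u v]] /=.
move=> neq_uv min_uv; exists (gap (val u - val v)); split.
  by exists (val u), (val v); split; rewrite ?fsvalP.
move=> _ [s' [t' [s'A t'A neq_st' ->]]].
exact: (min_uv ([` s'A]%fset, [` t'A]%fset)).
Qed.

(** Compared with the constant word [single_change s s], it differs in the first symbol only; such
    pairs attain the minimum determinant. *)
Definition single_change s t : 4.-tuple R[i] := [tuple t; s; s; s].

Lemma single_change_subset A s t :
  s \in A -> t \in A -> {subset single_change s t <= A}.
Proof.
by move=> sA tA z; rewrite !inE => /or4P[] /eqP->.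
Qed.

Lemma single_change_neq s t : s != t -> single_change s s != single_change s t.
Proof. by apply: contraNneq => /(congr1 (fun x : 4.-tuple R[i] => x`_0)) /= ->. Qed.

Lemma det_single_change a1 a2 s t :
  \det (codeword_diff a1 a2 (single_change s s) (single_change s t)) =
  (det_const a1 a2 * gap (s - t))%:C.
Proof.
rewrite det_codeword_diff /= subrr gapE /det_factor1 /det_factor2.
by rewrite /sqdiff /sqsum /= subrr addr0 expr0n /= !addr0.
Qed.

Lemma diff_dets_minimum A a1 a2 m : 0 < a1 -> 0 < a2 ->
  is_minimum (point_gaps A) m ->
  is_minimum (diff_dets a1 a2 A) (det_const a1 a2 * m)%:C.
Proof.
move=> a1_gt0 a2_gt0 [[s [t [sA tA neq_st ->]]] min_m]; split.
  exists (single_change s s), (single_change s t).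
  by split; rewrite ?single_change_neq ?det_single_change //;
     exact: single_change_subset.
move=> _ [x [y [sxA syA neq_xy ->]]].
have [u [v [uA vA neq_uv]]] := codeword_diff_gap a1_gt0 a2_gt0 sxA syA neq_xy.
apply: le_trans; rewrite lecR ler_pM2l ?det_const_gt0 //.
by apply: min_m; exists u, v.
Qed.

Lemma rank_codeword_diff A a1 a2 x y : 0 < a1 -> 0 < a2 ->
  (forall s t, s \in A -> t \in A -> s != t ->
     `|complex.Re (s - t)| != `|complex.Im (s - t)|) ->
  {subset x <= A} -> {subset y <= A} -> x != y ->
  \rank (codeword_diff a1 a2 x y) = 4.
Proof.
move=> a1_gt0 a2_gt0 gapA sxA syA neq_xy; apply: mxrank_unit.
have [s [t [sA tA neq_st le_det]]] :=
  codeword_diff_gap a1_gt0 a2_gt0 sxA syA neq_xy.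
rewrite unitmxE unitfE gt_eqF //; apply: lt_le_trans le_det.
rewrite ltcR mulr_gt0 ?det_const_gt0 // lt0r gap_eq0 gapA //=.
exact: sqr_ge0.
Qed.

End Determinant.

Unset Implicit Arguments.

Theorem mainTheorem5 (R : realType) (a1 a2 : R) (ha1 : 0 < a1) (ha2 : 0 < a2) :
  (exists K : R, 0 < K /\
     forall A : {fset R[i]}, (1 < #|` A|)%N ->
       exists m : R,
         is_minimum (point_gaps A) m /\
         is_minimum (diff_dets a1 a2 A) (K * m)%:C)
  /\
  (forall A : {fset R[i]}, (1 < #|` A|)%N ->
     (forall s t : R[i], s \in A -> t \in A -> s != t ->
        `|complex.Re (s - t)| != `|complex.Im (s - t)|) ->
     full_diversity a1 a2 A /\
     (forall x y : 4.-tuple R[i],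
        {subset x <= A} -> {subset y <= A} -> x != y ->
        \rank (codeword_diff a1 a2 x y) = 4%N)).
Proof.
split=> [|A A_gt1 gapA].
  (* The constant is fixed by the amplitudes before any constellation is chosen. *)
  exists (det_const a1 a2); split=> [|A A_gt1]; first exact: det_const_gt0.
  have [m min_m] := point_gaps_minimum A_gt1.
  by exists m; split=> //; exact: diff_dets_minimum.
have rank4 x y := @rank_codeword_diff _ _ _ _ x y ha1 ha2 gapA.
split=> //; split; last by move=> _ [x [y [sxA syA neq_xy ->]]]; rewrite rank4.
(* The minimal rank must also be attained, which takes one pair of distinct codewords. *)
have [s [t [sA tA neq_st]]] := exists_neq_fset A_gt1.
have subA := single_change_subset sA.
exists (single_change s s), (single_change s t).
by split; rewrite ?rank4 ?single_change_neq //; exact: subA.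
Qed.
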